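(* Let $K$ be a quartic number field having a real quadratic subfield $L$, and let $\eta\in K$ be a unit of degree $4$ over $\mathbb{Q}$ with $N_{K/\mathbb{Q}}(\eta)>0$ such that $\eta^2$ is a unit of $L$. Fix a nonzero $\beta\in K$ and put $\alpha(k)=\beta\eta^k$ for $k\in\mathbb{Z}_{\ge 0}$. Then there is an explicitly constructible $\mathbb{Z}$-basis $W=\{w_1,w_2,w_3,w_4\}$ of the $\mathbb{Z}$-module $M'=\beta\,\mathbb{Z}[\eta]$ such that, writing $\alpha(k)=x_1(k)w_1+x_2(k)w_2+x_3(k)w_3+x_4(k)w_4$ with $x_i(k)\in\mathbb{Z}$, the sequence $\{x_1(k):k\in\mathbb{Z}_{\ge0}\}$ is a linear divisibility sequence.
   Context: A linear divisibility sequence (LDS) is an integer sequence $b(k)$ satisfying a linear homogeneous recurrence with constant coefficients such that for all positive integers $n,m$, $n\mid m$ implies $b(n)\mid b(m)$. *)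

(* Defs.v *)
From mathcomp Require Import all_boot all_order all_algebra all_field.

Set Implicit Arguments.
Unset Strict Implicit.
Unset Printing Implicit Defensive.

Import Order.TTheory GRing.Theory Num.Theory.
Local Open Scope ring_scope.

(* A number field is a [fieldExtType rat]; its degree over rat is [\dim {:K}]. *)

(* A unit of the ring of integers of K. *)
Definition nf_unit (K : fieldExtType rat) (u : K) : Prop :=
  [/\ u != 0, integralOver (intr : int -> K) u
    & integralOver (intr : int -> K) u^-1].

(* The norm N_{K/Q}(x): determinant of the rat-linear map y |-> y * x. *)
Definition nf_norm (K : fieldExtType rat) (x : K) : rat :=
  \det (passmx.mxof (vbasis {:K}) (vbasis {:K}) (amulr x)).

(* All complex embeddings are real.  The image of a number field in the complex
   numbers consists of algebraic numbers, so algC is a sufficient codomain. *)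
Definition nf_real (L : fieldExtType rat) : Prop :=
  forall (s : {rmorphism L -> algC}) (x : L), s x \is Num.real.

(* [subvs_of L] is the subfield L seen as a number field in its own right. *)
Definition real_quadratic_subfield (K : fieldExtType rat) (L : {subfield K}) :
  Prop := \dim L = 2%N /\ nf_real (subvs_of L).

(* The Z-module beta Z[eta]. *)
Definition Zadjoin_scaled (K : fieldExtType rat) (beta eta : K) (x : K) : Prop :=
  exists p : {poly int}, x = beta * (map_poly intr p).[eta].

Definition is_Zbasis (V : zmodType) (M : V -> Prop) (n : nat)
    (w : n.-tuple V) : Prop :=
  (forall x, M x <->
     exists c : 'I_n -> int, x = \sum_(i < n) tnth w i *~ c i) /\
  (forall c : 'I_n -> int,
     \sum_(i < n) tnth w i *~ c i = 0 -> forall i, c i = 0).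

Definition linear_recurrent (b : nat -> int) : Prop :=
  exists (d : nat) (c : 'I_d -> int),
    forall k : nat, b (k + d)%N = \sum_(i < d) c i * b (k + i)%N.

Definition linear_divisibility_sequence (b : nat -> int) : Prop :=
  linear_recurrent b /\
  forall n m : nat, (0 < n)%N -> (0 < m)%N -> (n %| m)%N -> (b n %| b m)%Z.

(* Main.v *)
Require Import Defs.
From mathcomp Require Import all_boot all_order all_algebra all_field.
From mathcomp Require Import zify ring.
Set Implicit Arguments.
Unset Strict Implicit.
Unset Printing Implicit Defensive.
Import Order.TTheory GRing.Theory Num.Theory passmx.
Local Open Scope ring_scope.

(* Put e = eta^2. As e is a quadratic unit and N(eta) = N_{L/Q}(e) > 0, we have
   e^2 = t e - 1 with t an integer, so eta is a root of X^4 - t X^2 + 1 and every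
   linear functional of eta^k satisfies b(k+4) = t b(k+2) - b(k). The functional
   with values 0, 1, 1, t + 1 at k = 0, 1, 2, 3 yields the Lehmer numbers of the
   pair (eta, 1/eta), which form a divisibility sequence; it is the first
   coordinate in some Z-basis because its values on the basis 1, eta, eta^2,
   eta^3 are coprime. *)

(** * Lehmer numbers and their divisibility *)

(** The Lucas sequence U_n(t, 1), that is (v^n - v^-n) / (v - v^-1) where v + v^-1 = t. *)
Fixpoint chebU (t : int) (n : nat) : int :=
  if n is m.+1 then if m is l.+1 then t * chebU t m - chebU t l else 1 else 0.

Arguments chebU : simpl never.

Lemma chebUSS t n : chebU t n.+2 = t * chebU t n.+1 - chebU t n.
Proof. by []. Qed.

Lemma chebU_add t m n :
  chebU t (m + n).+1 = chebU t m.+1 * chebU t n.+1 - chebU t m * chebU t n.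
Proof.
elim: n m => [|n IHn] m; first by rewrite addn0 /chebU; ring.
by rewrite addnS -addSn IHn !chebUSS; ring.
Qed.

(* With u^2 + u^-2 = t these are the Lehmer numbers: for n even
   (u^n - u^-n) / (u^2 - u^-2), for n odd (u^n - u^-n) / (u - u^-1). *)
Definition lehmer (t : int) (n : nat) : int :=
  if odd n then chebU t n./2 + chebU t n./2.+1 else chebU t n./2.

Lemma lehmer_double t n : lehmer t n.*2 = chebU t n.
Proof. by rewrite /lehmer odd_double doubleK. Qed.

Lemma lehmer_doubleS t n : lehmer t n.*2.+1 = chebU t n + chebU t n.+1.
Proof. by rewrite /lehmer /= odd_double /= uphalf_double. Qed.

Lemma lehmer_rec t n : lehmer t n.+4 = t * lehmer t n.+2 - lehmer t n.
Proof. by rewrite /lehmer /= !negbK; case: odd; rewrite !chebUSS; ring. Qed.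

Lemma lehmer_add t m n :
  lehmer t (m.+2 + n.*2) =
    chebU t n.+1 * lehmer t m.+2 - chebU t n * lehmer t m.
Proof.
elim: n m => [|n IHn] m; first by rewrite addn0 /=; ring.
rewrite doubleS !addnS -!addSn IHn lehmer_rec (chebUSS t n); ring.
Qed.

(** This reflects u^(2n) - u^(-2n) = (u^n - u^-n)(u^n + u^-n). The integer cofactor is
    [chebU t j.+2 - chebU t j] for n = 2(j + 1) and [chebU t j.+1 - chebU t j] for n = 2j + 1. *)
Lemma lehmer_dvd_chebU t n : (lehmer t n %| chebU t n)%Z.
Proof.
rewrite -(odd_double_half n); case: odd; last first.
  rewrite add0n lehmer_double; case: n./2 => // j.
  have -> : (j.+1.*2 = (j + j.+1).+1)%N by lia.
  by rewrite chebU_add mulrC -mulrBl dvdz_mull.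
rewrite add1n lehmer_doubleS addrC -addnn chebU_add -!expr2 subr_sqr.
exact: dvdz_mull.
Qed.

(** Induction on the quotient in steps of two: [lehmer_add] with shift 2n leaves one term divisible
    by induction and one divisible through [chebU t n]. The cases n < 2 and m = 2n are separate
    because [lehmer_add] needs m - 2n >= 2. *)
Lemma lehmer_dvd t n m : (n %| m)%N -> (lehmer t n %| lehmer t m)%Z.
Proof.
case: n => [|[|n]]; [by rewrite dvd0n => /eqP-> | by rewrite dvd1z |].
case/dvdnP => k ->{m}; elim/ltn_ind: k => -[|[|k]] IHk.
- by rewrite dvdz0.
- by rewrite mul1n.
have -> : (k.+2 * n.+2 = k * n.+2 + n.+2.*2)%N by lia.
case: k IHk => [_|k IHk].
  by rewrite mul0n add0n lehmer_double lehmer_dvd_chebU.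
rewrite mulSn [in X in (_ %| X)%Z]addSn [(n.+1 + _)%N]addSn lehmer_add.
apply: rpredB.
  by apply: dvdz_mull; rewrite -!addSn -mulSn IHk.
by apply: dvdz_mulr; exact: lehmer_dvd_chebU.
Qed.

Lemma lehmer_lds t : linear_divisibility_sequence (lehmer t).
Proof.
split=> [|n m _ _]; last exact: lehmer_dvd.
exists 4%N, (fun i : 'I_4 => [:: -1; 0; t; 0]`_i) => k.
by rewrite !big_ord_recl big_ord0 /= !addnS addn0 lehmer_rec; ring.
Qed.

(** * Characteristic polynomials, integrality and norms *)

(** In coordinates, multiplication by p(x) is p(A); apply Cayley-Hamilton at y = 1. *)
Lemma root_char_poly_mul (F : fieldType) (K : fieldExtType F) (x : K) n
    (r : {linear K -> 'rV[F]_n}) (A : 'M[F]_n) :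
    injective r -> (forall y, r (y * x) = r y *m A) ->
  root (map_poly (in_alg K) (char_poly A)) x.
Proof.
case: n r A => [|n] r A r_inj rA.
  have /eqP := r_inj 1 0 (etrans (thinmx0 _) (esym (thinmx0 _))).
  by rewrite oner_eq0.
have rp (p : {poly F}) y :
    r (y * (map_poly (in_alg K) p).[x]) = r y *m horner_mx A p.
  elim/poly_ind: p y => [|p c IHp] y.
    by rewrite !rmorph0 horner0 mulr0 linear0 mulmx0.
  rewrite !rmorphD !rmorphM /= map_polyX map_polyC horner_mx_X horner_mx_C.
  rewrite !hornerE mulrDr linearD /= mulrA rA IHp mulmxDr -mulmxA.
  by rewrite mulmxE mul_mx_scalar -scalerAr mulr1 linearZ.
apply/eqP/r_inj; rewrite linear0 -[_.[x]]mul1r rp.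
by rewrite Cayley_Hamilton mulmx0.
Qed.

Lemma poly_root_lt_degree (F : fieldType) (K : fieldExtType F) (x : K)
    (p : {poly F}) :
  root (map_poly (in_alg K) p) x -> (size p <= adjoin_degree 1%VS x)%N -> p = 0.
Proof.
move=> px; rewrite -ltnS -size_minPoly -(size_map_poly (in_alg K)).
move=> lt_p; apply: (@map_poly_inj _ _ (in_alg K)); rewrite rmorph0.
apply/eqP; apply: contraTT lt_p => p_neq0; rewrite -leqNgt.
by rewrite dvdp_leq // minPoly_dvdp ?alg_polyOver.
Qed.

(** Embedding into [algC] reduces this to the fact that rational algebraic integers are integers. *)
Lemma integral_rat_int (K : fieldExtType rat) (q : rat) :
  integralOver (intr : int -> K) q%:A -> exists z : int, q = z%:~R.
Proof.
case=> p p_monic.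
have -> : map_poly intr p = map_poly (in_alg K) (map_poly intr p).
  by rewrite -map_poly_comp; apply: eq_map_poly => z /=; rewrite scaler_int.
rewrite (fmorph_root (in_alg K)) -(fmorph_root (@ratr algC)) -map_poly_comp.
move=> rq; have /intrP [z zq] : ratr q \is a @Num.int algC.
  apply: Cint_rat_Aint; first exact: Crat_rat.
  apply: root_monic_Aint rq _ _; first exact: monic_map.
  by apply/polyOverP => i; rewrite coef_map /= ratr_int.
by exists z; apply: (fmorph_inj (@ratr algC)); rewrite /= zq ratr_int.
Qed.

Lemma integral_root_minPoly (K : fieldExtType rat) (x y : K) :
  integralOver (intr : int -> K) x -> root (minPoly 1 x) y ->
  integralOver (intr : int -> K) y.
Proof.
case=> p p_monic px xy; exists p => //.
have/dvdpP[u ->] : minPoly 1 x %| map_poly intr p; last by rewrite rootM xy orbT.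
apply: minPoly_dvdp px.
by apply/polyOverP => i; rewrite coef_map /= -scaler_int memvZ ?mem1v.
Qed.

(** The conjugate a - e of e is integral too, so the trace a and the norm -b are integral
    rationals. *)
Lemma integral_quadratic_int (K : fieldExtType rat) (e : K) (a b : rat) :
    e \notin 1%VS -> e ^+ 2 = a *: e + b%:A ->
    integralOver (intr : int -> K) e ->
  (exists z : int, a = z%:~R) /\ (exists z : int, b = z%:~R).
Proof.
move=> eQ e2 e_int.
pose q : {poly K} := ('X - e%:P) * ('X - (a%:A - e)%:P).
have qE : q = Poly [:: - b%:A; - a%:A; 1].
  rewrite /q /= !cons_poly_def polyC0 mul0r add0r mul1r !polyCN polyCB.
  have -> : b%:A = e ^+ 2 - a%:A * e by rewrite e2 mulr_algl addrC addKr.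
  by rewrite !polyCB !polyCM; ring.
have e'_int : integralOver (intr : int -> K) (a%:A - e).
  apply: integral_root_minPoly e_int _.
  have q_size : size q = 3%N by rewrite qE (@PolyK _ 0) //= oner_eq0.
  have q_dvd : minPoly 1 e %| q.
    apply: minPoly_dvdp; last by rewrite /q rootM !root_XsubC eqxx.
    rewrite qE; apply/polyOverP => i; rewrite coef_Poly.
    by case: i => [|[|[|i]]]; rewrite /= ?nth_nil ?rpredN ?memvZ ?mem1v ?mem0v.
  (* As e is irrational, its minimal polynomial has degree at least 2, so it is associated to its
     multiple q. *)
  have -> : root (minPoly 1 e) =1 root q.
    apply: eqp_root; rewrite -dvdp_size_eqp // eqn_leq dvdp_leq //=; last first.
      by rewrite -size_poly_eq0 q_size.
    rewrite q_size size_minPoly ltnS; move: eQ; rewrite -adjoin_deg_eq1.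
    by rewrite /adjoin_degree; case: (_.-1).
  by rewrite /q rootM !root_XsubC eqxx orbT.
split; apply: (@integral_rat_int K).
  by rewrite -[_%:A](subrKC e) addrC; apply: integral_add.
have -> : b%:A = - (e * (a%:A - e)).
  by rewrite mulrBr -expr2 e2 mulr_algr opprB addrAC subrr add0r.
by apply/integral_opp/integral_mul.
Qed.

(** The characteristic polynomial and p are monic of the same degree and vanish at the generator x;
    their difference has too small a degree to be nonzero. *)
Lemma nf_norm_monic_root (K : fieldExtType rat) (x : K) (p : {poly rat}) :
    adjoin_degree 1%VS x = \dim {:K} -> p \is monic ->
    size p = (\dim {:K}).+1 -> root (map_poly (in_alg K) p) x ->
  nf_norm x = (-1) ^+ \dim {:K} * p`_0.
Proof.
move=> x_deg p_monic p_size px; rewrite /nf_norm.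
set A := mxof _ _ _; have K_basis := vbasisP {:K}.
have chiA : root (map_poly (in_alg K) (char_poly A)) x.
  apply: (root_char_poly_mul (r := rVof (vbasis {:K}))).
    exact: can_inj (rVofK K_basis).
  by move=> y; rewrite -(rVof_app _ K_basis) lfunE.
suff <- : char_poly A = p by rewrite char_poly_det signrMK.
apply/eqP; rewrite -subr_eq0; apply/eqP.
apply: (@poly_root_lt_degree _ _ x).
  by rewrite rmorphB rootE hornerD hornerN (eqP px) (eqP chiA) subrr.
rewrite x_deg; apply/leq_sizeP => j; rewrite leq_eqVlt coefB => /predU1P[<-|lt_j].
  have /monicP := char_poly_monic A; have /monicP := p_monic.
  by rewrite !lead_coefE size_char_poly p_size /= => -> ->; rewrite subrr.
by rewrite !nth_default ?subrr ?size_char_poly ?p_size.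
Qed.

(** * The quartic equation of the unit *)

Lemma quartic_unit_relation (K : fieldExtType rat) (L : {subfield K}) (eta : K) :
    \dim {:K} = 4%N -> \dim L = 2%N -> nf_unit eta ->
    adjoin_degree 1%VS eta = 4%N -> 0 < nf_norm eta -> eta ^+ 2 \in L ->
  exists t : int, eta ^+ 4 = eta ^+ 2 *~ t - 1.
Proof.
move=> dimK dimL [eta_neq0 eta_int etaV_int] eta_deg eta_norm etaL.
set e := eta ^+ 2 in etaL *.
(* Otherwise eta would be a root of X^2 - c, of degree less than 4. *)
have eQ : e \notin 1%VS.
  apply/negP => /vlineP[c ec].
  have := @poly_root_lt_degree _ _ eta ('X^2 - c%:P).
  rewrite size_XnsubC // eta_deg => H.
  have /eqP: 'X^2 - c%:P = 0 :> {poly rat}.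
    apply: H => //; rewrite rmorphB /= map_polyXn map_polyC /=.
    by rewrite rootE !hornerE -ec subrr.
  by rewrite -size_poly_eq0 size_XnsubC.
have [a [b e2]] : exists a b : rat, e ^+ 2 = a *: e + b%:A.
  have e_deg : (adjoin_degree 1%VS e <= 2)%N.
    rewrite -dimL adjoin_degreeE dimv1 divn1; apply/dimvS/FadjoinP.
    by rewrite sub1v.
  have [q qE] := polyOver1P (Fadjoin_polyOver 1%VS e (e ^+ 2)).
  have /Fadjoin_poly_eq : e ^+ 2 \in <<1; e>>%VS by rewrite rpredX ?memv_adjoin.
  rewrite qE (@horner_coef_wide _ 2); last first.
    by rewrite -qE (leq_trans (size_Fadjoin_poly _ _ _)).
  rewrite !big_ord_recl big_ord0 /= !coef_map /= addr0 mulr1 mulr_algl => <-.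
  by exists q`_1, q`_0; rewrite addrC.
have b_neq0 : b != 0.
  apply: contraNneq eQ => b0; move/eqP: e2; rewrite b0 scale0r addr0.
  rewrite expr2 -mulr_algl (inj_eq (mulIf _)) ?expf_neq0 // => /eqP ->.
  by rewrite memvZ ?mem1v.
have [[t tE] [z zE]] :=
  integral_quadratic_int eQ e2 (integral_mul eta_int eta_int).
have e_neq0 : e != 0 by rewrite expf_neq0.
(* Dividing by b e^2 gives an equation for e^-1 with constant term 1/b; integrality of e^-1 then
   makes 1/b an integer. *)
have e2V : e^-1 ^+ 2 = (- a / b) *: e^-1 + (b^-1)%:A.
  apply: (scalerI b_neq0); rewrite scalerDr !scalerA mulrCA !divff // mulr1.
  have bE : b%:A = e ^+ 2 - a%:A * e by rewrite e2 mulr_algl addrC addKr.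
  rewrite scale1r scaleNr -[b *: (_ ^+ 2)]mulr_algl bE -[a *: e^-1]mulr_algl.
  by field.
have [_ [y yE]] : (exists z, - a / b = z%:~R) /\ (exists z : int, b^-1 = z%:~R).
  apply: integral_quadratic_int e2V _; first by rewrite memvV.
  by rewrite /e expr2 invfM; apply: integral_mul.
(* The norm of eta is the constant term -b of X^4 - a X^2 - b. *)
have b_neg : b < 0.
  pose p : {poly rat} := Poly [:: -b; 0; - a; 0; 1].
  have p_seq : p = [:: -b; 0; - a; 0; 1] :> seq rat.
    by rewrite (@PolyK _ 0) ?oner_eq0.
  rewrite -oppr_gt0; move: eta_norm.
  rewrite (@nf_norm_monic_root _ _ p) ?dimK ?p_seq //.
  - by rewrite mul1r.
  - by rewrite monicE lead_coefE p_seq.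
  rewrite rootE /p /= !cons_poly_def polyC0 mul0r add0r polyC1 mul1r.
  rewrite !addr0 !(rmorphD, rmorphM) /= !map_polyX !map_polyC /= !hornerE /=.
  have -> : (- b)%:A = e * (a%:A - e).
    by rewrite mulrBr -expr2 e2 mulr_algr opprD addNKr scaleNr.
  by rewrite /e scaleNr; apply/eqP; ring.
exists t.
have -> : eta ^+ 4 = e ^+ 2 by rewrite -exprM.
rewrite e2 tE scaler_int; congr (_ + _).
suff -> : b = -1 by rewrite scaleN1r.
have zy : z * y = 1 by apply/eqP; rewrite -(eqr_int rat) intrM -zE -yE divff.
rewrite zE in b_neg *; rewrite ltrz0 in b_neg.
have y_neg : y < 0 by nia.
by have -> : z = -1 by nia.
Qed.

(** * Powers of the unit and the Z-basis *)

(** For e = x^2 this is e^j = U_j e - U_(j-1), with U_(j-1) rewritten as t U_j - U_(j+1) so that j =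
    0 is covered. *)
Lemma expr_quartic (R : comNzRingType) (x : R) (t : int) j :
    x ^+ 4 = x ^+ 2 *~ t - 1 ->
  x ^+ j.*2 = x ^+ 2 *~ chebU t j + (chebU t j.+1 - t * chebU t j)%:~R.
Proof.
move=> x4; elim: j => [|j IHj]; first by rewrite /chebU expr0; ring.
rewrite doubleS !exprSr IHj chebUSS.
transitivity (x ^+ 4 *~ chebU t j + x ^+ 2 *~ (chebU t j.+1 - t * chebU t j)).
  by ring.
by rewrite x4; ring.
Qed.

Lemma Zadjoin_quartic (R : comNzRingType) (x : R) (t : int) (p : {poly int}) :
    x ^+ 4 = x ^+ 2 *~ t - 1 ->
  exists c0 c1 c2 c3 : int, (map_poly intr p).[x] =
    c0%:~R + x *~ c1 + x ^+ 2 *~ c2 + x ^+ 3 *~ c3.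
Proof.
move=> x4; elim/poly_ind: p => [|p c [c0 [c1 [c2 [c3 IHp]]]]].
  by exists 0, 0, 0, 0; rewrite rmorph0 horner0; ring.
exists (c - c3), c0, (c1 + c3 * t), c2.
rewrite rmorphD rmorphM /= map_polyX map_polyC /= !hornerE IHp.
transitivity (c%:~R + x *~ c0 + x ^+ 2 *~ c1 + x ^+ 3 *~ c2 + x ^+ 4 *~ c3).
  by ring.
by rewrite x4; ring.
Qed.

Lemma Zindep_quartic (K : fieldExtType rat) (x : K) (c0 c1 c2 c3 : int) :
    adjoin_degree 1%VS x = 4%N ->
    c0%:~R + x *~ c1 + x ^+ 2 *~ c2 + x ^+ 3 *~ c3 = 0 ->
  [/\ c0 = 0, c1 = 0, c2 = 0 & c3 = 0].
Proof.
move=> x_deg xc; pose p : {poly rat} := Poly (map intr [:: c0; c1; c2; c3]).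
have p0 : p = 0.
  apply: (@poly_root_lt_degree _ _ x).
    rewrite rootE (@horner_coef_wide _ 4); last first.
      by rewrite size_map_poly (leq_trans (size_Poly _)).
    rewrite !big_ord_recl big_ord0 !coef_map !coef_Poly /= !scaler_int.
    by apply/eqP; rewrite -[RHS]xc; ring.
  by rewrite x_deg (leq_trans (size_Poly _)).
have coef0 i : (map intr [:: c0; c1; c2; c3] : seq rat)`_i = 0.
  by rewrite -coef_Poly -/p p0 coef0.
split; apply/eqP; rewrite -(eqr_int rat); apply/eqP.
- exact: coef0 0%N.
- exact: coef0 1%N.
- exact: coef0 2%N.
- exact: coef0 3%N.
Qed.

Theorem theorem1 (K : fieldExtType rat) (L : {subfield K}) (eta beta : K)
  (K_quartic : \dim {:K} = 4%N)
  (L_real_quadratic : real_quadratic_subfield L)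
  (eta_unit : nf_unit eta)
  (eta_deg : adjoin_degree 1%VS eta = 4%N)
  (eta_norm : 0 < nf_norm eta)
  (eta2_unit : exists2 e : subvs_of L, nf_unit e & vsval e = eta ^+ 2)
  (beta_neq0 : beta != 0) :
  {w : 4.-tuple K | is_Zbasis (Zadjoin_scaled beta eta) w &
    exists2 x : 'I_4 -> nat -> int,
      forall k : nat, beta * eta ^+ k = \sum_(i < 4) tnth w i *~ x i k
    & linear_divisibility_sequence (x ord0)}.
Proof.
(* The basis depends on t, so t must be extracted as data; decidability of the equation allows
   it. *)
have [t /eqP eta4] : {t : int | eta ^+ 4 == eta ^+ 2 *~ t - 1}.
  apply: sigW.
  have [dimL _] := L_real_quadratic; have [e _ eE] := eta2_unit.
  have [] := quartic_unit_relation K_quartic dimL eta_unit eta_deg eta_norm.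
    by rewrite -eE subvsP.
  by move=> t /eqP; exists t.
have eta_even := expr_quartic _ eta4.
(* The coordinate of beta * (y0 + y1 eta + y2 eta^2 + y3 eta^3) on the first
   vector of w is y1 + y2 + (t + 1) y3: the functional with values 0, 1, 1,
   t + 1 on 1, eta, eta^2, eta^3, which are the first Lehmer numbers. *)
pose w := [tuple beta * eta; beta; beta * (eta ^+ 2 - eta);
                 beta * (eta ^+ 3 - eta *~ (t + 1))].
(* The functional is 1 on the first vector (divided by beta), and the other three span its
   kernel. *)
have wE (c : 'I_4 -> int) : \sum_(i < 4) tnth w i *~ c i =
    beta * ((c (inord 1))%:~R
      + eta *~ (c (inord 0) - c (inord 2) - (t + 1) * c (inord 3))
      + eta ^+ 2 *~ c (inord 2) + eta ^+ 3 *~ c (inord 3)).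
  have -> : \sum_(i < 4) tnth w i *~ c i =
      \sum_(i < 4) w`_i *~ c (inord i).
    by apply: eq_bigr => i _; rewrite (tnth_nth 0) inord_val.
  by rewrite !big_ord_recl big_ord0 /=; ring.
pose vec (a b c d : int) (i : 'I_4) := nth a [:: a; b; c; d] i.
exists w; first split.
- move=> y; split=> [[p ->]|[c ->]].
    have [c0 [c1 [c2 [c3 ->]]]] := Zadjoin_quartic p eta4.
    exists (vec (c1 + c2 + (t + 1) * c3) c0 c2 c3).
    by rewrite wE /vec !inordK //=; ring.
  rewrite wE; set c0 := c (inord 1); set c1 := c _ - _ - _.
  set c2 := c (inord 2); set c3 := c (inord 3).
  exists (Poly [:: c0; c1; c2; c3]); rewrite (@horner_coef_wide _ 4).
    rewrite !big_ord_recl big_ord0 !coef_map !coef_Poly /=; ring.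
  by rewrite (leq_trans (size_poly _ _)) ?(leq_trans (size_Poly _)).
- move=> c; rewrite wE => /eqP; rewrite mulf_eq0 (negPf beta_neq0) /=.
  move=> /eqP /(Zindep_quartic eta_deg)[c1 c0 c2 c3] i.
  rewrite c2 c3 mulr0 !subr0 in c0.
  by rewrite -[i]inord_val; case: i => [[|[|[|[|//]]]]] /=.
(* Read off [expr_quartic]: even powers involve only 1 and eta^2, odd ones only eta and eta^3. For k
   = 2j + 1 the functional gives (U_(j+1) - t U_j) + (t + 1) U_j = U_j + U_(j+1). *)
pose x (i : 'I_4) (k : nat) := vec (lehmer t k)
  (if odd k then 0 else chebU t k./2.+1 - t * chebU t k./2)
  (if odd k then 0 else chebU t k./2) (if odd k then chebU t k./2 else 0) i.
exists x; last exact: lehmer_lds.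
move=> k; rewrite wE /x /vec !inordK //= /lehmer.
rewrite -[k in LHS]odd_double_half exprD eta_even.
by case: odd => /=; ring.
Qed.
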